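(* Let $(V,\omega)$ be a symplectic Fréchet space and let $L\subseteq V$ be a Lagrangian subspace which is split as a subspace, i.e. there is a closed subspace $K\subseteq V$ with $V=L\oplus K$. Then $L$ has a Lagrangian complement $L^c$ in $V$, i.e. there is a Lagrangian subspace $L^c\subseteq V$ with $V=L\oplus L^c$; hence $(L,L^c)$ is a splitting l-pair.
   Context: All vector spaces are real topological vector spaces, and $V^*$ denotes the space of continuous linear functionals on $V$. A weak symplectic vector space is a space $V$ with a skew-symmetric bilinear form $\omega$ such that $\omega^\sharp(v)=\omega(v,\cdot)$ defines an injective linear map $\omega^\sharp:V\to V^*$; it is symplectic if $\omega^\sharp$ is an isomorphism. For a subspace $W$, $W^\omega=\{v\in V:\omega(v,w)=0\ \forall w\in W\}$. A subspace $L$ is isotropic if $L\subseteq L^\omega$ and Lagrangian if $L=L^\omega$. A Lagrangian subspace which has a Lagrangian complement is called split Lagrangian; a pair $(L,L')$ of Lagrangian subspaces with $V=L\oplus L'$ is called a splitting l-pair. *)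

(* Defs.v *)
From HB Require Import structures.
From mathcomp Require Import all_boot all_order all_algebra.
From mathcomp Require Import all_classical all_reals all_analysis.

Set Implicit Arguments.
Unset Strict Implicit.
Unset Printing Implicit Defensive.

Import Order.TTheory GRing.Theory Num.Theory.
Import numFieldNormedType.Exports.

Local Open Scope classical_set_scope.
Local Open Scope ring_scope.

(* A [tvsType R] is locally convex by definition.  The uniformity it carries
   is only required to induce the topology, not to be translation invariant,
   so completeness must not be expressed with it: it is stated through the
   translation-invariant metric. *)
Record complete_invariant_metric (R : realType) (V : topologicalLmodType R)
    (d : V -> V -> R) : Prop := CompleteInvariantMetric {
  dist_eq0 : forall x y, d x y = 0 <-> x = y ;
  dist_sym : forall x y, d x y = d y x ;
  dist_triangle : forall x y z, d x z <= d x y + d y z ;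
  dist_translation : forall x y z, d (x + z) (y + z) = d x y ;
  dist_nbhs : forall x : V,
    nbhs x = filter_from [set e : R | 0 < e] (fun e => [set y | d x y < e]) ;
  dist_complete : forall u : nat -> V,
    (forall e : R, 0 < e ->
       exists N : nat, forall m n : nat,
         (N <= m)%N -> (N <= n)%N -> d (u m) (u n) < e) ->
    exists l : V, u @ \oo --> l }.

Definition frechet (R : realType) (V : tvsType R) : Prop :=
  exists d : V -> V -> R, complete_invariant_metric d.

Definition subspace_set (R : realType) (V : lmodType R) (W : set V) : Prop :=
  GRing.submod_closed [pred v | v \in W].

Definition direct_sum (R : realType) (V : lmodType R) (W W' : set V) : Prop :=
  W `&` W' = [set 0] /\
  forall v : V, exists2 w, W w & exists2 w', W' w' & v = w + w'.

Definition split_subspace (R : realType) (V : topologicalLmodType R)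
    (W : set V) : Prop :=
  subspace_set W /\
  exists K : set V, [/\ subspace_set K, closed K & direct_sum W K].

Definition continuous_dual (R : realType) (V : topologicalLmodType R) :
    set (V -> R) :=
  [set f : V -> R | scalar f /\ continuous f].

Definition sharp (R : realType) (V : lmodType R) (omega : {skew_symmetric V})
  : V -> (V -> R) := fun v => omega v.

(* Bilinearity makes [sharp omega] linear for the pointwise operations. *)
Definition weak_symplectic (R : realType) (V : topologicalLmodType R)
    (omega : {skew_symmetric V}) : Prop :=
  set_fun [set: V] (@continuous_dual R V) (sharp omega) /\
  injective (sharp omega).

(* The dual carries no topology, so "isomorphism" is one of vector spaces. *)
Definition symplectic (R : realType) (V : topologicalLmodType R)
    (omega : {skew_symmetric V}) : Prop :=
  weak_symplectic omega /\
  set_surj [set: V] (@continuous_dual R V) (sharp omega).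

Definition symp_orth (R : realType) (V : lmodType R)
    (omega : {skew_symmetric V}) (W : set V) : set V :=
  [set v | forall w, W w -> omega v w = 0].

Definition lagrangian (R : realType) (V : lmodType R)
    (omega : {skew_symmetric V}) (L : set V) : Prop :=
  subspace_set L /\ L = symp_orth omega L.

Definition splitting_lpair (R : realType) (V : lmodType R)
    (omega : {skew_symmetric V}) (L L' : set V) : Prop :=
  [/\ lagrangian omega L, lagrangian omega L' & direct_sum L L'].

(* Main.v *)
(* The projection p onto K along L has closed graph, since L = L^omega and K are
   closed, so it is continuous by the closed graph theorem for F-spaces.  Hence
   each functional -1/2 omega(p v, p -) is continuous and is represented by some
   A v; it vanishes on L, so A v lies in L^omega = L.  The factor 1/2 makes the
   range of p + A isotropic, and an isotropic complement of a Lagrangian subspace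
   is Lagrangian. *)
Require Import Defs.
From HB Require Import structures.
From mathcomp Require Import all_boot all_order all_algebra.
From mathcomp Require Import all_classical all_reals all_analysis.
From mathcomp Require Import lra.
Set Implicit Arguments.
Unset Strict Implicit.
Unset Printing Implicit Defensive.

Import Order.TTheory GRing.Theory Num.Theory.
Import numFieldNormedType.Exports.

Local Open Scope classical_set_scope.
Local Open Scope ring_scope.

(** * F-norms: invariant metrics measured from the origin *)

(** [N] is even and subadditive but not homogeneous, as for the distance to 0 in an invariant
    metric; scaling is controlled through continuity of scalar multiplication instead. *)
Record complete_fnorm (R : realType) (V : topologicalLmodType R)
    (N : V -> R) : Prop := CompleteFnorm {
  fnorm0 : N 0 = 0 ;
  fnormN : forall x, N (- x) = N x ;
  fnormD : forall x y, N (x + y) <= N x + N y ;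
  fnorm_nbhs : forall x : V,
    nbhs x = filter_from [set e : R | 0 < e] (fun e => [set y | N (y - x) < e]) ;
  fnorm_complete : forall u : nat -> V,
    (forall e : R, 0 < e -> exists n0 : nat, forall m n : nat,
       (n0 <= m)%N -> (n0 <= n)%N -> N (u m - u n) < e) ->
    exists l : V, u @ \oo --> l }.

Lemma complete_fnorm_dist (R : realType) (V : topologicalLmodType R)
    (d : V -> V -> R) :
  complete_invariant_metric d -> complete_fnorm (fun x : V => d x 0).
Proof.
move=> [d0 dC dD dT dN dF].
have dB x y : d (x - y) 0 = d x y by rewrite -(dT _ _ y) subrK add0r.
split=> [|x|x y|x|u uC].
- exact/d0.
- by rewrite -(dT _ _ x) addNr add0r dC.
- by apply: le_trans (dD _ y _) _; rewrite lerD2r -{2}(add0r y) dT.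
- rewrite dN; congr filter_from; apply/funext => e; apply/seteqP.
  by split=> y /=; rewrite dB dC.
- apply: dF => e /uC[n0 n0P]; exists n0 => m n hm hn.
  by rewrite -dB; exact: n0P.
Qed.

Lemma expr_half_lt (R : realType) (a e : R) :
  0 < e -> exists n : nat, a * 2^-1 ^+ n < e.
Proof.
move=> e0.
have h : `|2^-1 : R| < 1 by rewrite ger0_norm; lra.
have [n _ nP] := cvgr_lt _ (cvg_geometric a h) _ e0.
by exists n; exact: nP (leqnn n).
Qed.

Section CompleteFnorm.
Context (R : realType) (V : topologicalLmodType R) (N : V -> R).
Hypothesis NP : complete_fnorm N.

Lemma fnormB x y : N (x - y) = N (y - x).
Proof. by rewrite -(fnormN NP) opprB. Qed.

Lemma fnormBD y x z : N (x - z) <= N (x - y) + N (y - z).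
Proof. by rewrite -(subrK y x) -addrA; rewrite subrK; exact: fnormD. Qed.

Lemma fnorm_ge0 x : 0 <= N x.
Proof.
have := fnormD NP x (- x); rewrite subrr (fnorm0 NP) (fnormN NP); lra.
Qed.

Lemma fnormMn x n : N (x *+ n) <= N x *+ n.
Proof.
elim: n => [|n IHn]; first by rewrite !mulr0n (fnorm0 NP).
by rewrite !mulrS (le_trans (fnormD NP _ _))// lerD2l.
Qed.

Lemma nbhs_fnormP (x : V) (A : set V) :
  nbhs x A <-> exists2 e : R, 0 < e & forall y, N (y - x) < e -> A y.
Proof. by rewrite (fnorm_nbhs NP); split=> -[e e0 eA]; exists e. Qed.

Lemma cvg_fnormP (u : nat -> V) (l : V) :
  u @ \oo --> l <->
  forall e : R, 0 < e -> exists n0, forall n, (n0 <= n)%N -> N (u n - l) < e.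
Proof.
split=> [ul e e0|ul A].
  have [|n0 _ n0P] := ul [set y | N (y - l) < e].
    by apply/nbhs_fnormP; exists e.
  by exists n0 => n /n0P.
case/nbhs_fnormP=> e e0 eA; have [n0 n0P] := ul _ e0.
by exists n0 => // n /n0P /eA.
Qed.

(** The geometric bound makes [u] Cauchy; the sharper rate [r] passes to the limit, so that the
    limit stays in the closed balls of radius [r n]. *)
Lemma fnorm_rate_cvg (u : nat -> V) (r : nat -> R) (a : R) :
  (forall n, r n <= a * 2^-1 ^+ n) ->
  (forall m n, (n <= m)%N -> N (u m - u n) <= r n) ->
  exists2 l : V, u @ \oo --> l & forall n, N (l - u n) <= r n.
Proof.
move=> ra ur; have [l ul] : exists l : V, u @ \oo --> l.
  apply: (fnorm_complete NP) => e e0.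
  have [|n0 n0P] := @expr_half_lt R a (e / 2); first lra.
  exists n0 => m n /ur hm /ur hn.
  have := fnormBD (u n0) (u m) (u n); rewrite [N (u n0 - _)]fnormB.
  have := ra n0; lra.
exists l => // n; apply/ler_addgt0Pr => e e0.
have [n0 n0P] := (cvg_fnormP u l).1 ul _ e0.
have := n0P (maxn n0 n) (leq_maxl _ _).
have := ur (maxn n0 n) n (leq_maxr _ _).
have := fnormBD (u (maxn n0 n)) l (u n); rewrite [N (l - u (maxn _ _))]fnormB; lra.
Qed.

(* The conclusion says that the closure of some S n contains a ball. *)
Lemma fnorm_baire (S : nat -> set V) : (forall x, exists n, S n x) ->
  exists n x, exists2 r : R, 0 < r & forall y, N (y - x) < r ->
    forall e : R, 0 < e -> exists2 s, S n s & N (s - y) < e.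
Proof.
move=> Scov; apply: contrapT => nS.
(* [q] is a centre with a radius: its closed ball sits inside the previous one and avoids [S np.1].
   The guard on the old radius lets choice range over all pairs. *)
have step (np : nat * (V * R)) : exists q : V * R, 0 < np.2.2 ->
    [/\ 0 < q.2, q.2 <= np.2.2 / 2 &
        forall z, N (z - q.1) <= q.2 -> N (z - np.2.1) <= np.2.2 /\ ~ S np.1 z].
  case: np => n [x r] /=; have [r0|r0] := ltP 0 r; last by exists (0, 0).
  have [y [yx [e e0 ye]]] : exists y, N (y - x) < r / 2 /\
      exists2 e : R, 0 < e & forall s, S n s -> e <= N (s - y).
    apply: contrapT => ny; apply: nS; exists n, x, (r / 2); first lra.
    move=> y yx e e0; apply: contrapT => ns; apply: ny; exists y; split=> //.
    exists e => // s Ss; rewrite leNgt; apply/negP => se.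
    by apply: ns; exists s.
  (* [r / 2] keeps the ball inside the old one, [e / 2] keeps it off [S n]. *)
  exists (y, Num.min (r / 2) (e / 2)) => _ /=; split.
  - by rewrite lt_min; apply/andP; split; lra.
  - by rewrite ge_min lexx.
  - move=> z; rewrite le_min => /andP[zr ze]; split.
      by have := fnormBD y z x; lra.
    by move=> /ye; lra.
have [F FP] := choice step.
pose c := fix c n := if n is m.+1 then F (m, c m) else (0, 1).
have c0 n : 0 < (c n).2 by elim: n => //= n IHn; have [] := FP (n, c n) IHn.
have c2 n : (c n).2 <= 1 * 2^-1 ^+ n.
  elim: n => [|n IHn]; first by rewrite expr0 mulr1.
  have [_ /= h _] := FP (n, c n) (c0 n); apply: le_trans h _.
  by rewrite exprSr mulrA ler_pM2r// invr_gt0.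
have cS m n z : (n <= m)%N -> N (z - (c m).1) <= (c m).2 ->
    N (z - (c n).1) <= (c n).2.
  move=> /subnK <-; elim: (m - n)%N => // k IHk /= h; apply: IHk.
  by have [_ _ /(_ z h)[]] := FP ((k + n)%N, c (k + n)%N) (c0 _).
have [m n nm|l _ lc] := @fnorm_rate_cvg (fun n => (c n).1) _ _ c2.
  by apply: cS nm _; rewrite subrr (fnorm0 NP) ltW.
(* The limit lies in ball [n.+1], which was built to avoid [S n]. *)
have [n Sn] := Scov l.
by have [_ _ /(_ l (lc n.+1))[]] := FP (n, c n) (c0 n).
Qed.

(** Joint continuity of scaling replaces homogeneity: below, it is used at [(a, 0)] with the scalar
    fixed and at [(0, x)] with the vector fixed. *)
Lemma fnormZ_near (a : R^o) (x : V) (e : R) : 0 < e ->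
  exists2 A, nbhs a A & exists2 r : R, 0 < r &
    forall b y, A b -> N (y - x) < r -> N (b *: y - a *: x) < e.
Proof.
move=> e0.
have /= := @scale_continuous R V (a, x) [set y | N (y - a *: x) < e].
case=> [|[A B] /= [aA /nbhs_fnormP[r r0 rB]] AB].
  by apply/nbhs_fnormP; exists e.
exists A => //; exists r => // b y Ab yr.
by apply: (AB (b, y)); split=> //; exact: rB.
Qed.

Lemma fnormZ_small (a : R) (e : R) : 0 < e ->
  exists2 r : R, 0 < r & forall x, N x < r -> N (a *: x) < e.
Proof.
move=> /(fnormZ_near a 0)[A /nbhs_singleton aA [r r0 rP]].
by exists r => // x; have := rP a x aA; rewrite scaler0 !subr0.
Qed.

Lemma fnorm_absorb (x : V) (e : R) : 0 < e ->
  exists n : nat, N (n.+1%:R^-1 *: x) < e.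
Proof.
move=> /(fnormZ_near 0 x)[A A0 [r r0 rP]].
have [n _ nP] := (@cvg_harmonic R : _ --> (0 : R^o)) _ A0.
exists n; have := rP n.+1%:R^-1 x (nP n (leqnn n)).
by rewrite scale0r subr0; apply; rewrite subrr (fnorm0 NP).
Qed.

End CompleteFnorm.

(** * The closed graph theorem *)

Section ClosedGraph.
Context (R : realType) (V W : topologicalLmodType R) (N : V -> R) (M : W -> R).
Hypotheses (NP : complete_fnorm N) (MP : complete_fnorm M).
Variable p : {linear V -> W}.

(** By absorption the preimages of dilated balls cover [V], so Baire makes one of them dense in a
    ball; taking differences moves that ball to the origin, and dividing by [n.+1] undoes the
    dilation. *)
Lemma fnorm_nearly_continuous (e : R) : 0 < e ->
  exists2 r : R, 0 < r & forall y, N y < r ->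
    forall e', 0 < e' -> exists2 t, M (p t) < e & N (t - y) < e'.
Proof.
move=> e0.
have [|n [x [r r0 rP]]] := @fnorm_baire R V N NP
    (fun n => [set x | M (n.+1%:R^-1 *: p x) < e / 2]).
  by move=> x; apply: (fnorm_absorb MP); lra.
have n0 : (n.+1%:R : R) != 0 by rewrite pnatr_eq0.
have dense z e' : 0 < e' -> N z < r ->
    exists2 s, M (n.+1%:R^-1 *: p s) < e & N (s - z) < e'.
  move=> e'0 zr.
  have e'2 : 0 < e' / 2 by lra.
  have [|s1 /= s1S s1z] := rP (x + z) _ _ e'2; first by rewrite addrC addKr.
  have [|s2 /= s2S s2z] := rP x _ _ e'2; first by rewrite subrr (fnorm0 NP).
  exists (s1 - s2).
    rewrite linearB scalerBr.
    have := fnormD MP (n.+1%:R^-1 *: p s1) (- (n.+1%:R^-1 *: p s2)).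
    by rewrite (fnormN MP); lra.
  have -> : s1 - s2 - z = (s1 - (x + z)) - (s2 - x).
    by rewrite opprB opprD [- x - z]addrC [s1 + (_ - x)]addrA -[RHS]addrA addKr addrAC.
  have := fnormD NP (s1 - (x + z)) (- (s2 - x)); rewrite (fnormN NP); lra.
(* Subadditivity alone then puts [y *+ n.+1] in the ball of radius [r]. *)
exists (r / n.+1%:R); first by rewrite divr_gt0// ltr0n.
move=> y yr e' e'0.
have [r' r'0 r'P] := fnormZ_small NP n.+1%:R^-1 e'0.
have [||s sS sy] := @dense (y *+ n.+1) r' => //.
  by apply: le_lt_trans (fnormMn NP _ _) _; rewrite -mulr_natr -ltr_pdivlMr ?ltr0n.
exists (n.+1%:R^-1 *: s); first by rewrite linearZ.
by have := r'P _ sy; rewrite scalerBr -[y *+ _]scaler_nat scalerA mulVf// scale1r.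
Qed.

(* Near continuity lets x be exhausted greedily by terms t_n with M (p t_n) < a n:
   the partial sums x - y n tend to x while their images converge. *)
Lemma closed_graph_continuous :
  (forall (u : nat -> V) x y, u @ \oo --> x -> p \o u @ \oo --> y -> p x = y) ->
  continuous p.
Proof.
move=> pcl.
suff p0 (e : R) : 0 < e -> exists2 r : R, 0 < r & forall x, N x < r -> M (p x) < e.
  move=> x A /(nbhs_fnormP MP)[e e0 eA]; have [r r0 rP] := p0 e e0.
  apply/(nbhs_fnormP NP); exists r => // y yr; apply: eA.
  by rewrite -linearB; exact: rP.
(* The [a n] sum to [e / 2], strictly below [e]. *)
move=> e0; pose a n : R := e / 4 * 2^-1 ^+ n.
have half0 n : 0 < (2^-1 : R) ^+ n by rewrite exprn_gt0// invr_gt0.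
have a0 n : 0 < a n by rewrite mulr_gt0//; lra.
have /choice[D DP] n : exists r : R, 0 < r /\ forall y, N y < r ->
    forall e', 0 < e' -> exists2 t, M (p t) < a n & N (t - y) < e'.
  by have [r r0 rP] := fnorm_nearly_continuous (a0 n); exists r.
(* [D n] makes the approximation available at stage [n]; the power of 1/2 forces the remainders
   [y n] to 0. *)
pose r n := Num.min (D n) (2^-1 ^+ n).
have r0 n : 0 < r n by rewrite lt_min half0 (DP n).1.
exists (r 0%N) => // x xr.
have /choice[F FP] (ny : nat * V) : exists t, N ny.2 < r ny.1 ->
    M (p t) < a ny.1 /\ N (ny.2 - t) < r ny.1.+1.
  case: ny => n y /=; have [yr|ry] := ltP (N y) (r n); last by exists 0.
  have [|t tM tN] := (DP n).2 y _ _ (r0 n.+1).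
    by apply: lt_le_trans yr _; rewrite ge_min lexx.
  by exists t => _; rewrite (fnormB NP).
pose y := fix y n := if n is m.+1 then y m - F (m, y m) else x.
have yr n : N (y n) < r n.
  by elim: n => //= n IHn; have [] := FP (n, y n) IHn.
have aS n : a n.+1 = a n / 2 by rewrite /a exprSr mulrA.
(* The bound is the sum of [a k] over [n <= k < m], in telescoped form. *)
have My m n : (n <= m)%N -> M (p (x - y m) - p (x - y n)) <=
    2 * a n - 2 * a m.
  elim: m => [|m IHm]; first by rewrite leqn0 => /eqP->; rewrite !subrr (fnorm0 MP).
  rewrite leq_eqVlt => /predU1P[->|]; first by rewrite !subrr (fnorm0 MP).
  rewrite ltnS => /IHm IH; have [tM _] := FP (m, y m) (yr m).
  have := fnormBD MP (p (x - y m)) (p (x - y m.+1)) (p (x - y n)).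
  rewrite -[in X in _ <= X]linearB.
  have -> : x - y m.+1 - (x - y m) = F (m, y m).
    rewrite [y m.+1]/=; move: (y m) (F _) => b c.
    by rewrite !opprB addrC addrA subrK addrC subrK.
  by move: tM IH; rewrite aS /=; lra.
have [] := @fnorm_rate_cvg R W M MP (fun n => p (x - y n)) (fun n => 2 * a n) (e / 2).
- by move=> n; rewrite /a; lra.
- by move=> m n /My; have := a0 m; lra.
move=> l ul lP.
have -> : p x = l.
  apply: (pcl (fun n => x - y n)) ul; apply/(cvg_fnormP NP) => e' e'0.
  have [n0 n0P] := @expr_half_lt R 1 e' e'0; rewrite mul1r in n0P.
  exists n0 => n nn0; rewrite addrAC subrr add0r (fnormN NP).
  apply: lt_trans (yr n) _; apply: le_lt_trans n0P.
  rewrite ge_min; apply/orP; right; apply: ler_wiXn2l => //; lra.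
(* Since [y 0] is [x], the partial sum at 0 vanishes and [M l <= 2 * a 0 = e / 2]. *)
have := lP 0%N; rewrite /= subrr linear0 subr0 /a expr0; lra.
Qed.

End ClosedGraph.

(** * Projections and Lagrangian complements *)

Lemma direct_sum_proj (R : realType) (V : lmodType R) (W K : set V) :
  subspace_set W -> subspace_set K -> direct_sum W K ->
  exists p : {linear V -> V}, forall v, K (p v) /\ W (v - p v).
Proof.
move=> [W0 WZD] [K0 KZD] [WK0 WKT].
have WZ a u v : W u -> W v -> W (a *: u + v).
  by move=> Wu Wv; have := WZD a u v; rewrite !inE; apply.
have KZ a u v : K u -> K v -> K (a *: u + v).
  by move=> Ku Kv; have := KZD a u v; rewrite !inE; apply.
have /choice[p pP] v : exists k, K k /\ W (v - k).
  by have [w Ww [k Kk ->]] := WKT v; exists k; rewrite addrK.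
have plin : linear p.
  move=> a u v; apply/subr0_eq.
  (* The linearity defect is a combination of values of [p], and also of values of [v - p v]. *)
  have : (W `&` K) (p (a *: u + v) - (a *: p u + p v)); last by rewrite WK0.
  have [[Ku Wu] [Kv Wv]] := (pP u, pP v); have [Ks Ws] := pP (a *: u + v).
  split.
    have -> : p (a *: u + v) - (a *: p u + p v) =
        (-1) *: (a *: u + v - p (a *: u + v)) + (a *: (u - p u) + (v - p v)).
      rewrite scaleN1r opprB scalerBr.
      by rewrite [_ - _ + (v - _)]addrACA -opprD addrA subrK.
    by apply: (WZ _ _ _ Ws); exact: WZ.
  by rewrite addrC -scaleN1r; apply: (KZ _ _ _ _ Ks); exact: KZ.
pose q : {linear V -> V} := HB.pack p (GRing.isLinear.Build _ _ _ _ p plin).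
by exists q.
Qed.

Lemma skewC (R : realType) (V : lmodType R) (omega : {skew_symmetric V}) u v :
  omega u v = - omega v u.
Proof. by rewrite hermC expr1 mulN1r. Qed.

(** An orthogonal is an intersection of kernels of the continuous functionals [omega w];
    skew-symmetry moves [w] to the first slot. *)
Lemma closed_symp_orth (R : realType) (V : topologicalLmodType R)
    (omega : {skew_symmetric V}) (W : set V) :
  weak_symplectic omega -> closed (symp_orth omega W).
Proof.
move=> [womega _].
have -> : symp_orth omega W = \bigcap_(w in W) (omega w @^-1` [set 0]).
  apply/seteqP; split=> v vW w Ww; have /= vw := vW w Ww.
    by rewrite /= skewC vw oppr0.
  by rewrite skewC vw oppr0.
apply: closed_bigI => w _.
have [_ wc] := womega w I.
by apply: (continuous_closedP _).1 wc _ _; exact: closed_eq.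
Qed.

Lemma lagrangian_proj_complement (R : realType) (V : topologicalLmodType R)
    (omega : {skew_symmetric V}) (L : set V) (p : {linear V -> V}) :
  symplectic omega -> lagrangian omega L -> continuous p ->
  (forall v, L (v - p v)) -> (forall v, L v -> p v = 0) ->
  exists Lc, lagrangian omega Lc /\ direct_sum L Lc.
Proof.
move=> [[womega inj] surj] [[L0 LZD] LE] pc Lp pL.
have /choice[A AE] v : exists a, forall x, omega a x = - 2^-1 * omega (p v) (p x).
  have [|a _ aE] := surj (fun x => - 2^-1 * omega (p v) (p x)).
    split.
      by move=> k x y; rewrite linearP linearDr linearZr mulrDr mulrCA.
    move=> x; apply: (@cvgZl_tmp _ R^o); apply: (continuous_comp (f := p)).
      exact: pc.
    exact: (womega (p v) I).2.
  by exists a => x; exact: (congr1 (@^~ x) aE).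
have oP k u v x : omega (k *: u + v) x = k * omega u x + omega v x.
  by rewrite linearDl linearZl_LR.
have Alin : linear A.
  move=> k u v; apply: inj; apply/funext => x.
  by rewrite /sharp AE linearP !oP !AE mulrDr mulrCA.
have p0 v : p v = 0 -> A v = 0.
  by move=> pv0; apply: inj; apply/funext => x; rewrite /sharp AE pv0 !linear0l mulr0.
have LA v : L (A v) by rewrite LE => x Lx; rewrite AE (pL x)// linear0r mulr0.
have pp u : p (p u) = p u.
  by have := pL _ (Lp u); rewrite linearB => /subr0_eq.
(* Each cross term equals [- 2^-1 * omega (p v) (p w)], so together they cancel
   [omega (p v) (p w)]. *)
have T0 v w : omega (p v + A v) (p w + A w) = 0.
  have LAA : omega (A v) (A w) = 0.
    by have := LA v; rewrite LE; apply.
  rewrite !linearDl !linearDr /= LAA addr0 (skewC _ (p v) (A w)) !AE !pp.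
  rewrite (skewC _ (p w)); lra.
have Lid v : L (v - (p v + A v)).
  have := LZD (-1) (A v) (v - p v); rewrite !inE => /(_ (LA v) (Lp v)).
  by rewrite scaleN1r addrC opprD addrA.
have rLc : subspace_set (range (fun v => p v + A v)).
  split=> [|k u v]; rewrite !inE.
    by exists 0; rewrite // linear0 p0 ?linear0// addr0.
  move=> [x _ <-] [y _ <-]; exists (k *: x + y) => //.
  by rewrite linearP Alin scalerDr addrACA.
exists (range (fun v => p v + A v)); split; first split=> //.
  apply/seteqP; split=> [_ [v _ <-] _ [w _ <-]|v vT]; first exact: T0.
  suff -> : v = p v + A v by exists v.
  (* Test [v - (p v + A v)], which is in [L], against [x] split along [L] and the range: the [L]
     part gives 0 as [L] is isotropic, the range part by [vT] and [T0]. *)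
  apply/subr0_eq; apply: inj; apply/funext => x.
  have Lv := Lid v; rewrite LE in Lv.
  rewrite /sharp linear0l -(subrK (p x + A x) x) linearDr /= (Lv _ (Lid x)) add0r.
  by rewrite linearBl /= T0 vT ?subr0//; exists x.
split; last first.
  move=> v; exists (v - (p v + A v)); first exact: Lid.
  by exists (p v + A v); [exists v|rewrite subrK].
apply/seteqP; split=> [x [Lx [v _ vx]]|_ ->]; last first.
  split; first by move: L0; rewrite inE.
  by exists 0; rewrite // linear0 p0 ?linear0// addr0.
(* Applying [p] to [p v + A v], an element of [L], leaves [p v], since [p] is idempotent and kills
   [A v]. *)
have pv0 : p v = 0.
  by move: Lx; rewrite -vx => /pL; rewrite linearD pp (pL (A v)) ?addr0.
by rewrite /= -vx pv0 p0 ?addr0.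
Qed.

Theorem theorem2p10 (R : realType) (V : tvsType R)
    (omega : {skew_symmetric V}) (L : set V) :
  frechet V -> symplectic omega ->
  lagrangian omega L -> split_subspace L ->
  exists Lc : set V,
    (lagrangian omega Lc /\ direct_sum L Lc) /\ splitting_lpair omega L Lc.
Proof.
move=> [d dP] sV lL [subL [K [subK clK LK]]].
have NP := complete_fnorm_dist dP.
have [p pP] := direct_sum_proj subL subK LK.
have clL : closed L by rewrite lL.2; exact: closed_symp_orth sV.1.
(* Uniqueness of components: it turns the closed graph condition into two membership statements
   about limits. *)
have LK_uniq x k : K k -> L (x - k) -> p x = k.
  move=> Kk Lxk; have [Kp Lp] := pP x; apply/subr0_eq.
  have : (L `&` K) (p x - k); last by rewrite LK.1.
  split.
    have := subL.2 (-1) (x - p x) (x - k); rewrite !inE; move=> /(_ Lp Lxk).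
    by rewrite scaleN1r opprB addrA subrK.
  have := subK.2 (-1) k (p x); rewrite !inE; move=> /(_ Kk Kp).
  by rewrite scaleN1r addrC.
have pc : continuous p.
  apply: (closed_graph_continuous NP NP) => u x y ux puy.
  have Ky : K y.
    by apply: closed_cvg puy => //; apply: nearW => n; exact: (pP _).1.
  apply: LK_uniq => //.
  (* The [L] components converge to [x - y], so closedness of [L] gives the second membership. *)
  have uxy : (fun n => u n - p (u n)) @ \oo --> x - y.
    apply/(cvg_fnormP NP) => e e0; have e2 : 0 < e / 2 by lra.
    have [n1 h1] := (cvg_fnormP NP _ _).1 ux _ e2.
    have [n2 h2] := (cvg_fnormP NP _ _).1 puy _ e2.
    exists (maxn n1 n2) => n; rewrite geq_max => /andP[/h1 h3 /h2 /= h4].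
    have := fnormD NP (u n - x) (- (p (u n) - y)); rewrite (fnormN NP).
    have -> : u n - x - (p (u n) - y) = u n - p (u n) - (x - y).
      by rewrite !opprB addrACA [RHS]addrACA [- x + _]addrC.
    lra.
  by apply: closed_cvg uxy => //; apply: nearW => n; exact: (pP _).2.
have [Lc [lLc LLc]] : exists Lc, lagrangian omega Lc /\ direct_sum L Lc.
  apply: lagrangian_proj_complement sV lL pc (fun v => (pP v).2) _ => v Lv.
  by apply: LK_uniq; [have := subK.1; rewrite inE|rewrite subr0].
by exists Lc; split.
Qed.
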